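(* Let $P,p$ be real numbers with $1<P<pP$. Let $\alpha$ be defined by $P^{\alpha}=p^{1-\alpha}$ and let $c=2\left(\alpha P+(1-\alpha)\frac1p-1\right)$. Then there is $n_0=n_0(p,P)$ such that for any $R\in\mathbb{N}$, any harmonic $u:B_{\lceil pPR\rceil}\to\mathbb{R}$, where $B_{\lceil pPR\rceil}\subseteq\mathbb{Z}^d$, and any $0\le\varepsilon\le0.5$, $$Q_u(\lfloor Pn\rfloor)\le e^{cn^{-2\varepsilon}}Q_u(n)^{\alpha}Q_u(\lceil pPn\rceil)^{1-\alpha}+p^{-n^{0.5-\varepsilon}}Q_u(\lceil pPn\rceil)$$ for all integers $n_0\le n\le R$.
   Context: $\mathbb{Z}^d$ carries its standard nearest-neighbour graph structure, $|x|_1$ denotes graph distance from $0$, and $B_R=\{x\in\mathbb{Z}^d:|x|_1\le R\}$. The Laplacian is $(\Delta f)(x)=\frac{1}{2d}\sum_{y\sim x}(f(y)-f(x))$. A function $u:B_R\to\mathbb{R}$ is harmonic if $(\Delta u)(x)=0$ at every $x$ all of whose neighbours lie in $B_R$ (i.e. $|x|_1\le R-1$). $(X_n)_{n\ge0}$ is the simple random walk on $\mathbb{Z}^d$ starting at $0$, and for $u:B_R\to\mathbb{R}$ and integers $0\le n\le R$, $Q_u(n):=\mathbb{E}(u(X_n)^2)$. *)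

(* Defs.v *)
From HB Require Import structures.
From mathcomp Require Import all_boot all_order all_algebra.
From mathcomp Require Import all_classical all_reals all_analysis.
From mathcomp Require Import zify.

Set Implicit Arguments.
Unset Strict Implicit.
Unset Printing Implicit Defensive.

Import Order.TTheory GRing.Theory Num.Theory.

Local Open Scope classical_set_scope.
Local Open Scope ring_scope.

Notation lattice d := 'rV[int]_d.

(* The 2d unit vectors: the neighbours of x are the points x + unit_step s. *)
Definition unit_step (d : nat) (s : 'I_d * bool) : lattice d :=
  if s.2 then delta_mx 0 s.1 else - delta_mx 0 s.1.

Definition norm1 (d : nat) (x : lattice d) : nat := (\sum_(i < d) `|x 0%R i|)%N.

Lemma norm1_unit_step d (s : 'I_d * bool) : norm1 (unit_step s) = 1%N.
Proof.
rewrite /norm1 (bigD1 s.1) //= big1 => [|i ne].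
  by rewrite /unit_step; case: s.2; rewrite !mxE !eqxx.
by rewrite /unit_step; case: s.2; rewrite !mxE (negbTE ne) ?andbF.
Qed.

Lemma norm1D d (x y : lattice d) : (norm1 (x + y) <= norm1 x + norm1 y)%N.
Proof.
rewrite /norm1 -big_split /=; apply: leq_sum => i _; rewrite mxE.
by rewrite -lez_nat PoszD !abszE ler_normD.
Qed.

(* norm1 is the graph distance from 0. *)
Lemma norm1_graph_distance d (x : lattice d) (n : nat) :
  (norm1 x <= n)%N <->
  exists2 s : seq ('I_d * bool), (size s <= n)%N & x = \sum_(i <- s) unit_step i.
Proof.
split=> [|[s sn ->]]; last first.
  apply: leq_trans sn; elim: s => [|a s IH].
    by rewrite big_nil /norm1 big1 // => i _; rewrite mxE.
  rewrite big_cons; apply: leq_trans (norm1D _ _) _.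
  by rewrite norm1_unit_step add1n ltnS.
elim: n x => [|n IH] x hx.
  exists [::] => //; rewrite big_nil; apply/rowP => i; rewrite mxE.
  move: hx; rewrite leqn0 /norm1 sum_nat_eq0 => /forallP /(_ i) /=.
  by rewrite absz_eq0 => /eqP.
have [->|/rV0Pn [i xi]] := eqVneq x 0; first by exists [::]; rewrite ?big_nil.
pose b := 0 < x 0 i.
have hy : (norm1 (x - unit_step (i, b)) < norm1 x)%N.
  rewrite /norm1 (bigD1 i) //= [X in (_ < X)%N](bigD1 i) //= -addSn.
  apply: leq_add; last first.
    apply: leq_sum => j ji; rewrite /unit_step /=.
    by case: b; rewrite !mxE (negbTE ji) andbF ?oppr0 ?subr0 ?addr0.
  rewrite /unit_step /= /b; move: xi.
  by case: ifP => h xi; rewrite !mxE !eqxx /=; move: h xi;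
    move: (x 0 i) => z; lia.
have [s sn xE] := IH _ (leq_trans hy hx).
by exists ((i, b) :: s) => //; rewrite big_cons -xE subrKC.
Qed.

Definition l1ball (d M : nat) : set (lattice d) := [set x | (norm1 x <= M)%N].

Definition laplacian (R : realType) (d : nat) (f : lattice d -> R)
    (x : lattice d) : R :=
  (2 * d%:R)^-1 * \sum_(s : 'I_d * bool) (f (x + unit_step s) - f x).

(* Only the values of u on the ball matter. *)
Definition harmonic_on_ball (R : realType) (d M : nat) (u : lattice d -> R) :
    Prop :=
  forall x, (forall s, l1ball M (x + unit_step s)) -> laplacian u x = 0.

(* V is regarded as discrete: all its subsets are events. *)
Definition mutually_independent (R : realType) (dsp : measure_display)
    (T : measurableType dsp) (Pr : probability T R) (V : Type)
    (xi : nat -> T -> V) : Prop :=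
  forall (J : seq nat) (A : nat -> set V), uniq J ->
    (Pr (\bigcap_(j in [set` J]) (xi j @^-1` A j)) =
     \prod_(j <- J) Pr (xi j @^-1` A j))%E.

Definition simple_random_walk (R : realType) (d : nat) (dsp : measure_display)
    (T : measurableType dsp) (Pr : probability T R)
    (X : nat -> T -> lattice d) : Prop :=
  let xi n w := X n.+1 w - X n w in
  [/\ forall w, X 0%N w = 0,
      forall n (A : set (lattice d)), measurable (X n @^-1` A),
      forall n s, Pr (xi n @^-1` [set unit_step s]) = ((2 * d%:R)^-1)%:E &
      mutually_independent Pr xi].

(* The expectation is finite for each n, as X n takes finitely many values
   almost surely. *)
Definition Q (R : realType) (d : nat) (dsp : measure_display)
    (T : measurableType dsp) (Pr : probability T R)
    (X : nat -> T -> lattice d) (u : lattice d -> R) (n : nat) : R :=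
  fine ('E_Pr[fun w => (u (X n w) ^+ 2)%R])%E.

(* Main.v *)
(* L denotes the Laplacian and M = 1 + L the averaging operator, so that
   Q_u(n) = (M^n u^2)(0) = \sum_k 'C(n, k) (L^k u^2)(0).  Where u is harmonic,
   L(u^2) is the average of the squares of the differences u(. + s) - u, which
   are again harmonic on a ball of radius one less; hence (L^k u^2)(0) >= 0 for
   all k up to the radius.  It remains to compare binomial coefficients: for
   k >= n^(1/2 - e), 'C(Pn, k) <= p^-k 'C(pPn, k), while for k <= n^(1/2 - e),
   'C(Pn, k) <= exp(c k^2 / n) 'C(n, k)^alpha 'C(pPn, k)^(1 - alpha), and the
   latter terms are summed by Hoelder's inequality. *)
Require Import Defs.
From HB Require Import structures.
From mathcomp Require Import all_boot all_order all_algebra.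
From mathcomp Require Import all_classical all_reals all_analysis.
From mathcomp Require Import measurable_realfun ring lra.

Set Implicit Arguments.
Unset Strict Implicit.
Unset Printing Implicit Defensive.

Import Order.TTheory GRing.Theory Num.Theory.

Local Open Scope ring_scope.

(** * Binomial coefficients and absolutely monotone sequences *)

(** Young's inequality for the conjugate exponents 1/a and 1/(1 - a), applied to x^a and y^(1 -
    a). *)
Lemma powR_weighted_AGM (R : realType) (a x y : R) :
  0 < a < 1 -> 0 <= x -> 0 <= y ->
  x `^ a * y `^ (1 - a) <= a * x + (1 - a) * y.
Proof.
move=> /andP[a0 a1] x0 y0; have b0 : 0 < 1 - a by rewrite subr_gt0.
have := @conjugate_powR R (x `^ a) (y `^ (1 - a)) a^-1 (1 - a)^-1
  (powR_ge0 _ _) (powR_ge0 _ _).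
rewrite !invr_gt0 !invrK => /(_ a0 b0).
rewrite -!powRrM !divff ?gt_eqF// !powRr1// [x * a]mulrC [y * _]mulrC.
by apply; rewrite addrC subrK.
Qed.

(** Hoelder's inequality with exponents 1/a and 1/(1 - a). Induction reduces it to two terms, which
    are normalised by their sums and bounded by the weighted mean inequality. *)
Lemma powR_hoelder_sum (R : realType) (I : Type) (r : seq I) (a : R)
    (f g : I -> R) :
  0 < a < 1 -> (forall i, 0 <= f i) -> (forall i, 0 <= g i) ->
  \sum_(i <- r) f i `^ a * g i `^ (1 - a) <=
  (\sum_(i <- r) f i) `^ a * (\sum_(i <- r) g i) `^ (1 - a).
Proof.
move=> a01 f0 g0; have /andP[a0 a1] := a01.
have b0 : 0 < 1 - a by rewrite subr_gt0.
elim: r => [|i r]; first by rewrite !big_nil powR0 ?mul0r// gt_eqF.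
rewrite !big_cons.
have F0 : 0 <= \sum_(j <- r) f j by exact: sumr_ge0.
have G0 : 0 <= \sum_(j <- r) g j by exact: sumr_ge0.
move: (f i) (f0 i) (\sum_(j <- r) f j) F0 => x x0 X X0.
move: (g i) (g0 i) (\sum_(j <- r) g j) G0 => y y0 Y Y0 IH.
apply: le_trans (lerD (lexx _) IH) _.
(* A vanishing sum cannot be normalised; its terms are then 0, and so are their powers with positive
   exponent. *)
have [XE|Xn] := eqVneq (x + X) 0.
  have -> : x = 0 by lra.
  have -> : X = 0 by lra.
  by rewrite addr0 !powR0 ?gt_eqF// !mul0r addr0.
have [YE|Yn] := eqVneq (y + Y) 0.
  have -> : y = 0 by lra.
  have -> : Y = 0 by lra.
  by rewrite addr0 !powR0 ?gt_eqF// !mulr0 addr0.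
have S0 : 0 < x + X by rewrite lt_def Xn addr_ge0.
have T0 : 0 < y + Y by rewrite lt_def Yn addr_ge0.
have sc u v : 0 <= u -> 0 <= v -> u `^ a * v `^ (1 - a) <=
    (a * (u / (x + X)) + (1 - a) * (v / (y + Y))) *
    ((x + X) `^ a * (y + Y) `^ (1 - a)).
  move=> u0 v0.
  have -> : u `^ a * v `^ (1 - a) =
      ((u / (x + X)) `^ a * (v / (y + Y)) `^ (1 - a)) *
      ((x + X) `^ a * (y + Y) `^ (1 - a)).
    by rewrite mulrACA -!powRM ?divr_ge0 ?(ltW S0) ?(ltW T0)// !divfK.
  rewrite ler_wpM2r ?mulr_ge0 ?powR_ge0// powR_weighted_AGM//.
    by rewrite divr_ge0// ltW.
  by rewrite divr_ge0// ltW.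
apply: le_trans (lerD (sc _ _ x0 y0) (sc _ _ X0 Y0)) _.
rewrite -mulrDl addrACA -!mulrDr -!mulrDl !divff// !mulr1.
by rewrite addrC subrK mul1r.
Qed.

(** Inverse of 1 + t <= e^t at t = x / (1 - x), where 1 + t = 1 / (1 - x). *)
Lemma expRN_le1B (R : realType) (x : R) : x < 1 -> expR (- (x / (1 - x))) <= 1 - x.
Proof.
move=> x1; have y0 : 0 < 1 - x by rewrite subr_gt0.
rewrite expRN -[leRHS]invrK lef_pV2 ?posrE ?invr_gt0 ?expR_gt0//.
apply: le_trans (expR_ge1Dx _).
by rewrite le_eqVlt; apply/orP; left; apply/eqP; field; rewrite gt_eqF.
Qed.

(** * The exponent [al] and the rate [c] *)

Section exponents.
Context (R : realType) (P p al c : R).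
Hypotheses (P1 : 1 < P) (p1 : 1 < p).
Hypothesis hal : P `^ al = p `^ (1 - al).
Hypothesis hc : c = 2 * (al * P + (1 - al) * (1 / p) - 1).

Let P0 : 0 < P. Proof. by rewrite (lt_trans _ P1). Qed.
Let p0 : 0 < p. Proof. by rewrite (lt_trans _ p1). Qed.

Lemma exponent_ln : al * ln P = (1 - al) * ln p.
Proof. by rewrite -!ln_powR hal. Qed.

(** As [ln P] and [ln p] are positive, [exponent_ln] gives [al] and [1 - al] the same sign, and they
    add up to 1. *)
Lemma exponent_gt0lt1 : 0 < al < 1.
Proof.
have LP : 0 < ln P by rewrite ln_gt0.
have Lp : 0 < ln p by rewrite ln_gt0.
have := exponent_ln; nra.
Qed.

(** Makes the leading terms agree: P n = n^al (p P n)^(1 - al). *)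
Lemma exponentE : P = (p * P) `^ (1 - al).
Proof.
rewrite powRM ?(ltW p0) ?(ltW P0)// -hal -powRD ?(gt_eqF P0) ?implybT//.
by rewrite addrC subrK powRr1// ltW.
Qed.

(** P > 1 + ln P and 1/p > 1 - ln p; in the weighted sum the logarithms cancel by [exponent_ln]. *)
Lemma exponent_rate_gt0 : 0 < c.
Proof.
have /andP[a0 a1] := exponent_gt0lt1.
have LP : 0 < ln P by rewrite ln_gt0.
have Lp : 0 < ln p by rewrite ln_gt0.
have h1 : 1 + ln P < P by rewrite -[ltRHS]lnK ?posrE// expR_gt1Dx ?gt_eqF.
have h2 : 1 - ln p < 1 / p.
  rewrite div1r -[in ltRHS](@lnK _ p) ?posrE// -expRN expR_gt1Dx//.
  by rewrite oppr_eq0 gt_eqF.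
have := exponent_ln; rewrite hc; nra.
Qed.

(* With x = i / n, the logarithms of the three factors have first-order terms
   - x / P, - x and - x / (p P), and al + (1 - al) / (p P) = (1 + c / 2) / P;
   the bound i <= c / (2 (1 + c)) n leaves room for the higher-order terms. *)
Lemma shifted_factor_le (n N m i : R) :
  0 < n -> 0 <= i -> i <= c / (2 * (1 + c)) * n ->
  m <= P * n -> p * P * n <= N ->
  m - i <= expR (c * i / n) * ((n - i) `^ al * (N - i) `^ (1 - al)).
Proof.
move=> n0 i0 id mP PN.
have c0 := exponent_rate_gt0; have /andP[a0 a1] := exponent_gt0lt1.
pose x := i / n; have iE : i = x * n by rewrite /x divfK ?gt_eqF.
have x0 : 0 <= x by rewrite divr_ge0// ltW.
have xd : x * (2 * (1 + c)) <= c.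
  have : x <= c / (2 * (1 + c)) by rewrite /x ler_pdivrMr.
  by rewrite ler_pdivlMr//; lra.
have x1 : x < 1 by nra.
have x10 : 0 < 1 - x by lra.
have pP1 : 1 < p * P by apply: lt_trans p1 _; rewrite ltr_pMr.
have pP0 : 0 < p * P by lra.
pose y := x / (1 - x).
have hn : n * expR (- y) <= n - i.
  have -> : n - i = n * (1 - x) by rewrite iE; ring.
  by rewrite ler_pM2l// expRN_le1B.
have hN : p * P * n * expR (- (y / (p * P))) <= N - i.
  have xP : x / (p * P) <= x by rewrite ler_pdivrMr//; nra.
  apply: (@le_trans _ _ (p * P * n * (1 - x / (p * P)))); last first.
    have -> : p * P * n * (1 - x / (p * P)) = p * P * n - i.
      by rewrite iE; field; rewrite !gt_eqF.
    lra.
  rewrite ler_pM2l ?mulr_gt0//.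
  apply: le_trans (@expRN_le1B _ (x / (p * P)) _); last by lra.
  rewrite ler_expR lerN2 /y [leRHS]mulrAC ler_wpM2l ?divr_ge0 ?(ltW pP0) ?(ltW n0)//.
  by rewrite lef_pV2 ?posrE; lra.
have hm : m - i <= P * n * expR (- (x / P)).
  apply: (@le_trans _ _ (P * n * (1 - x / P))).
    have -> : P * n * (1 - x / P) = P * n - i.
      by rewrite iE; field; rewrite !gt_eqF.
    lra.
  by rewrite ler_pM2l ?mulr_gt0// expR_ge1Dx.
apply: le_trans hm _.
have b0 : 0 < 1 - al by lra.
apply: (@le_trans _ _ (expR (c * i / n) * ((n * expR (- y)) `^ al *
   (p * P * n * expR (- (y / (p * P)))) `^ (1 - al)))); last first.
  rewrite ler_wpM2l ?expR_ge0// ler_pM ?powR_ge0//.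
    have h : 0 <= n * expR (- y) by rewrite mulr_ge0 ?expR_ge0// ltW.
    by rewrite ge0_ler_powR ?nnegrE// ?(ltW a0)// (le_trans h).
  have h : 0 <= p * P * n * expR (- (y / (p * P))).
    by rewrite !mulr_ge0 ?expR_ge0// ltW.
  by rewrite ge0_ler_powR ?nnegrE// ?(ltW b0)// (le_trans h).
rewrite !(powRM, mulr_ge0) ?expR_ge0 ?(ltW n0) ?(ltW P0) ?(ltW p0)//.
rewrite -[p `^ _ * _](powRM _ (ltW p0) (ltW P0)) -exponentE -!expRM.
have -> : forall A B C D E : R, A * (B * C * (P * D * E)) =
     P * (B * D) * (A * (C * E)) by move=> *; ring.
rewrite -powRD ?(gt_eqF n0) ?implybT// addrC subrK powRr1 ?(ltW n0)//.
rewrite -!expRD ler_pM2l ?mulr_gt0// ler_expR.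
have -> : c * i / n = c * x by rewrite /x mulrA.
have -> : c * x + (- y * al + - (y / (p * P)) * (1 - al)) =
   c * x - y * ((1 + c / 2) / P).
  by rewrite hc; field; rewrite !gt_eqF.
(* For x > 0 this amounts to (1 + c) x <= c / 2, which is [xd]: the origin of the bound on i / n. *)
have hy : y * (1 + c / 2) <= (1 + c) * x.
  by rewrite /y mulrAC ler_pdivrMr//; nra.
have : y * ((1 + c / 2) / P) <= (1 + c) * x / P.
  by rewrite mulrA ler_pM2r ?invr_gt0.
have : c * x / P <= c * x.
  by rewrite ler_pdivrMr// ler_peMr ?(ltW P1)// mulr_ge0// ltW.
lra.
Qed.
End exponents.

(** * Comparison of binomial coefficients *)

Lemma natr_bin_left (R : pzRingType) (n k : nat) : (k <= n)%N ->
  k.+1%:R * 'C(n, k.+1)%:R = (n%:R - k%:R) * 'C(n, k)%:R :> R.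
Proof. by move=> kn; rewrite -natrM mul_bin_left natrM natrB. Qed.

(** Induction through the ratios of consecutive coefficients: m - k <= (N - k) / p, because p m <= N
    and p >= 1. *)
Lemma bin_dilate (R : realFieldType) (p : R) (m N k : nat) :
  0 < p -> p * m%:R <= N%:R -> (k <= N)%N -> 1 <= p ->
  'C(m, k)%:R <= p ^- k * 'C(N, k)%:R.
Proof.
move=> p0 pm kN p1; elim: k kN => [|k IH] kN; first by rewrite !bin0 expr0 invr1 mulr1.
have [mk|km] := leqP m k.
  by rewrite bin_small ?ltnS// mulr_ge0// invr_ge0 exprn_ge0// ltW.
rewrite -(@ler_pM2l _ k.+1%:R)// natr_bin_left ?(ltnW km)//.
rewrite mulrCA (natr_bin_left _ (ltnW kN)) exprS invfM.
have := IH (ltnW kN).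
have hk : 0 <= m%:R - k%:R :> R by rewrite subr_ge0 ler_nat ltnW.
move/(ler_wpM2l hk)/le_trans; apply.
have -> : forall A B C D : R, A * B * (C * D) = B * (A * C * D).
  by move=> *; ring.
rewrite mulrCA ler_wpM2l ?invr_ge0 ?exprn_ge0 ?(ltW p0)//.
rewrite ler_wpM2r// ler_pdivlMl//.
have : 0 <= (p - 1) * k%:R by rewrite mulr_ge0 ?subr_ge0.
lra.
Qed.

Section absolutely_monotone.
Context (R : realType) (P p al c : R).
Hypotheses (P1 : 1 < P) (p1 : 1 < p).
Hypothesis hal : P `^ al = p `^ (1 - al).
Hypothesis hc : c = 2 * (al * P + (1 - al) * (1 / p) - 1).

(** Passing from k to k + 1 costs a factor exp(c k / n) by [shifted_factor_le], and k + k^2 <= (k +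
    1)^2. *)
Lemma bin_interpolation (n N m k : nat) :
  (0 < n)%N -> m%:R <= P * n%:R -> p * P * n%:R <= N%:R -> (k <= n)%N ->
  k%:R <= c / (2 * (1 + c)) * n%:R ->
  'C(m, k)%:R <= expR (c * (k ^ 2)%:R / n%:R) *
    ('C(n, k)%:R `^ al * 'C(N, k)%:R `^ (1 - al)).
Proof.
move=> n0 mP PN; have nR : 0 < n%:R :> R by rewrite ltr0n.
have nN : (n <= N)%N.
  by rewrite -(ler_nat R) (le_trans _ PN)// ler_peMl ?mulr_ege1 ?ltW.
have c0 := exponent_rate_gt0 P1 p1 hal hc.
elim: k => [|k IH] kn kd.
  by rewrite !bin0 !powR1 !mulr1 mulr0 mul0r expR0.
have kd' : k%:R <= c / (2 * (1 + c)) * n%:R.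
  by apply: le_trans kd; rewrite ler_nat.
have {}IH := IH (ltnW kn) kd'.
have F := shifted_factor_le P1 p1 hal hc nR (ler0n _ k) kd' mP PN.
have [mk|km] := leqP m k.
  by rewrite bin_small ?ltnS// !mulr_ge0 ?expR_ge0 ?powR_ge0.
have kR : 0 < k.+1%:R :> R by rewrite ltr0n.
rewrite -(@ler_pM2l _ k.+1%:R)// natr_bin_left ?(ltnW km)//.
have hm : 0 <= m%:R - k%:R :> R by rewrite subr_ge0 ler_nat ltnW.
have hn : 0 <= n%:R - k%:R :> R by rewrite subr_ge0 ler_nat ltnW.
have hN : 0 <= N%:R - k%:R :> R.
  by rewrite subr_ge0 ler_nat (leq_trans _ nN)// ltnW.
apply: le_trans (ler_pM hm _ F IH) _ => //.
have -> : forall A B C D E G : R, A * (B * C) * (D * (E * G)) =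
     A * D * ((B * E) * (C * G)) by move=> *; ring.
rewrite -!powRM// -!natr_bin_left ?(ltnW kn) ?(leq_trans (ltnW kn))//.
rewrite !powRM// -expRD [leRHS]mulrCA.
have -> : forall B C D E : R, B * C * (D * E) = B * D * (C * E).
  by move=> *; ring.
rewrite -powRD ?(gt_eqF kR) ?implybT// [al + _]addrC subrK powRr1 ?(ltW kR)//.
apply: ler_wpM2r; first by rewrite !mulr_ge0 ?powR_ge0.
rewrite ler_expR -mulrDl ler_pM2r ?invr_gt0// -mulrDr ler_pM2l//.
by rewrite -natrD ler_nat -!mulnn mulSn mulnS leq_addl.
Qed.

(** The analytic core, free of the lattice: [f] has nonnegative Newton coefficients. Since [n0] is
    chosen before [f] and [e], it is later uniform in the dimension, the function and epsilon. *)
Lemma absolutely_monotone_three_points :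
  exists n0 : nat, forall (n m N : nat), (n0 <= n)%N ->
    m%:R <= P * n%:R -> p * P * n%:R <= N%:R ->
    forall (a : 'I_N.+1 -> R) (f : nat -> R), (forall k, 0 <= a k) ->
    (forall j, (j <= N)%N -> f j = \sum_k a k * 'C(j, k)%:R) ->
    forall e : R, 0 <= e <= 1 / 2 ->
    f m <= expR (c * n%:R `^ (- (2 * e))) * f n `^ al * f N `^ (1 - al) +
           p `^ (- n%:R `^ (1 / 2 - e)) * f N.
Proof.
have c0 := exponent_rate_gt0 P1 p1 hal hc.
have al01 := exponent_gt0lt1 P1 p1 hal; have /andP[al0 al1] := al01.
have p0 : 0 < p by rewrite (lt_trans _ p1).
pose del := c / (2 * (1 + c)).
have del0 : 0 < del by rewrite divr_gt0//; lra.
have del1 : del <= 1 by rewrite ler_pdivrMr; lra.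
(* This choice forces del^2 n >= 1, so that k^2 <= n implies k <= del n, the range of
   [bin_interpolation]. *)
exists (Num.bound (del ^- 2)).+1 => n m N n0n mP PN a f a0 fE e /andP[e0 e1].
have n0 : (0 < n)%N by apply: leq_trans n0n.
have nR : 0 < n%:R :> R by rewrite ltr0n.
have n1 : 1 <= n%:R :> R by rewrite ler1n.
have dn : 1 <= del ^+ 2 * n%:R.
  rewrite -ler_pdivrMl ?exprn_gt0// mulr1 ltW//.
  apply: lt_le_trans (archi_boundP _) _; first by rewrite invr_ge0 exprn_ge0// ltW.
  by rewrite ler_nat ltnW.
have nN : (n <= N)%N.
  by rewrite -(ler_nat R) (le_trans _ PN)// ler_peMl ?mulr_ege1 ?ltW.
have mN : (m <= N)%N.
  by rewrite -(ler_nat R) (le_trans mP)// (le_trans _ PN)// ler_pM2r//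
     ler_peMl ?ltW// (lt_trans _ P1).
rewrite !fE//; pose K : R := n%:R `^ (1 / 2 - e).
have low (k : nat) : k%:R <= K -> 'C(m, k)%:R <=
    expR (c * n%:R `^ (- (2 * e))) * ('C(n, k)%:R `^ al * 'C(N, k)%:R `^ (1 - al)).
  move=> kK.
  have k2 : (k ^ 2)%:R <= n%:R `^ (- (2 * e)) * n%:R.
    rewrite -[X in _ <= _ * X](@powRr1 _ n%:R) ?(ltW nR)// -powRD ?(gt_eqF nR) ?implybT//.
    have -> : - (2 * e) + 1 = (1 / 2 - e) + (1 / 2 - e) by lra.
    by rewrite powRD ?(gt_eqF nR) ?implybT// natrX expr2 ler_pM.
  have kn2 : k%:R ^+ 2 <= n%:R :> R.
    rewrite -natrX (le_trans k2)// ler_piMl ?(ltW nR)//.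
    by rewrite -[leRHS](@powRr0 _ n%:R) ler_powR//; lra.
  have kd : k%:R <= del * n%:R.
    have dn0 : 0 <= del * n%:R by rewrite mulr_ge0// ltW.
    by rewrite -(ler_sqr (ler0n _ k) dn0) (le_trans kn2)// exprMn [n%:R ^+ 2]expr2 mulrA ler_peMl.
  have kn : (k <= n)%N by rewrite -(ler_nat R) (le_trans kd)// ler_piMl.
  apply: le_trans (bin_interpolation n0 mP PN kn kd) _.
  rewrite ler_wpM2r ?mulr_ge0 ?powR_ge0// ler_expR -mulrA ler_pM2l//.
  by rewrite ler_pdivrMr.
have high (k : nat) : (k <= N)%N -> K <= k%:R -> 'C(m, k)%:R <= p `^ (- K) * 'C(N, k)%:R.
  move=> kN Kk; apply: (@le_trans _ _ (p ^- k * 'C(N, k)%:R)).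
    rewrite bin_dilate ?(ltW p1)// (le_trans _ PN)//.
    by rewrite -mulrA ler_pM2l.
  by rewrite ler_wpM2r// -powR_invn ?(ltW p0)// ler_powR ?(ltW p1)// lerN2.
(* Every term is bounded by the sum of both bounds, so the sum need not be split at [K]. *)
have term (k : 'I_N.+1) : a k * 'C(m, k)%:R <=
    expR (c * n%:R `^ (- (2 * e))) *
      ((a k * 'C(n, k)%:R) `^ al * (a k * 'C(N, k)%:R) `^ (1 - al)) +
    p `^ (- K) * (a k * 'C(N, k)%:R).
  have [kK|Kk] := leP k%:R K.
    apply: ler_wpDr; first by rewrite !mulr_ge0 ?powR_ge0.
    apply: le_trans (ler_wpM2l (a0 k) (low _ kK)) _.
    rewrite !powRM// [X in _ <= _ * X]mulrACA -powRD.
      by rewrite [al + _]addrC subrK powRr1// [leLHS]mulrCA.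
    by rewrite [al + _]addrC subrK oner_eq0.
  apply: ler_wpDl; first by rewrite !mulr_ge0 ?expR_ge0 ?powR_ge0.
  by rewrite [leRHS]mulrCA ler_wpM2l// high ?ltW// -ltnS.
apply: le_trans (ler_sum _ (fun k _ => term k)) _.
rewrite big_split /= -!mulr_sumr -/K lerD2r -mulrA ler_wpM2l ?expR_ge0//.
by apply: powR_hoelder_sum => // k; rewrite mulr_ge0.
Qed.
End absolutely_monotone.

(** * Powers of the discrete Laplacian *)

Section lattice_operators.
Context (R : realType) (d : nat).
Hypothesis d0 : (0 < d)%N.
Implicit Types (f g u : lattice d -> R) (x : lattice d).

Definition step_mean f x : R :=
  (2 * d%:R)^-1 * \sum_(s : 'I_d * bool) f (x + unit_step s).

Lemma card_unit_steps : #|{: 'I_d * bool}| = (2 * d)%N.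
Proof. by rewrite card_prod card_ord card_bool mulnC. Qed.

Lemma step_weight_gt0 : 0 < (2 * d%:R)^-1 :> R.
Proof. by rewrite invr_gt0 mulr_gt0// ltr0n. Qed.

Lemma step_mean_laplacian f x : step_mean f x = f x + laplacian f x.
Proof.
rewrite /laplacian big_split /= mulrDr sumrN sumr_const card_unit_steps.
rewrite -[f x *+ _]mulr_natl mulrN natrM mulKf; first by rewrite addrC subrK.
by rewrite mulf_neq0// pnatr_eq0 -?lt0n.
Qed.

Lemma laplacianD f g x :
  laplacian (fun y => f y + g y) x = laplacian f x + laplacian g x.
Proof.
rewrite /laplacian -mulrDr -big_split /=; congr (_ * _).
by apply: eq_bigr => s _; ring.
Qed.

Lemma laplacianZ (b : R) f x : laplacian (fun y => b * f y) x = b * laplacian f x.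
Proof.
rewrite /laplacian [RHS]mulrCA; congr (_ * _).
by rewrite mulr_sumr; apply: eq_bigr => s _; ring.
Qed.

Lemma laplacian_sum (I : Type) (r : seq I) (F : I -> lattice d -> R) x :
  laplacian (fun y => \sum_(i <- r) F i y) x = \sum_(i <- r) laplacian (F i) x.
Proof.
elim: r x => [|i r IH] x.
  rewrite big_nil /laplacian big1 ?mulr0// => s _.
  by rewrite !big_nil subrr.
rewrite big_cons -IH -laplacianD; congr laplacian.
by apply/funext => y; rewrite big_cons.
Qed.

Lemma iter_laplacianD k f g x : iter k (@laplacian R d) (fun y => f y + g y) x =
  iter k (@laplacian R d) f x + iter k (@laplacian R d) g x.
Proof.
elim: k f g => [//|k IH] f g; rewrite !iterSr -IH.
by congr (iter k _ _ x); apply/funext => y; rewrite laplacianD.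
Qed.

Lemma iter_laplacianZ_sum k (b : R) (I : Type) (r : seq I)
    (F : I -> lattice d -> R) x :
  iter k (@laplacian R d) (fun y => b * \sum_(i <- r) F i y) x =
  b * \sum_(i <- r) iter k (@laplacian R d) (F i) x.
Proof.
elim: k F => [//|k IH] F; rewrite iterSr.
under eq_bigr do rewrite iterSr.
rewrite -IH; congr (iter k _ _ x); apply/funext => y.
by rewrite laplacianZ laplacian_sum.
Qed.

(** Binomial expansion of (1 + L)^n. The sum runs to N so that one family of coefficients serves all
    times up to N; terms with k > n vanish. *)
Lemma iter_step_mean_newton n N f x : (n <= N)%N ->
  iter n step_mean f x =
  \sum_(k < N.+1) iter k (@laplacian R d) f x * 'C(n, k)%:R.
Proof.
elim: n N f => [|n IH] N f nN.
  rewrite big_ord_recl big1 => [|i _]; first by rewrite /= bin0 mulr1 addr0.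
  by rewrite bin0n mulr0.
have -> : iter n.+1 step_mean f x =
    iter n step_mean f x + iter n step_mean (laplacian f) x.
  rewrite iterSr (IH N _ (ltnW nN)).
  case: N nN => [//|N] nN; rewrite ltnS in nN.
  rewrite (IH N.+1 f (leqW nN)) (IH N.+1 (laplacian f) (leqW nN)) -big_split /=.
  apply: eq_bigr => k _; rewrite -mulrDl; congr (_ * _).
  rewrite -iter_laplacianD; congr (iter k _ _ x).
  by apply/funext => y; exact: step_mean_laplacian.
case: N nN => [//|N] nN; rewrite ltnS in nN.
(* The part with L f is expanded one order lower; after an index shift the sums combine by Pascal's
   rule. *)
rewrite (IH N.+1 f (leqW nN)) (IH N _ nN).
rewrite big_ord_recl [RHS]big_ord_recl /= !bin0 -addrA -big_split /=.
congr (_ + _); apply: eq_bigr => k _.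
by rewrite /bump /= add1n binS natrD mulrDr -iterSr.
Qed.

(** Each L reaches one step further. This allows replacing L(u^2) by a sum of squares known to equal
    it only near x. *)
Lemma iter_laplacian_local k f g x :
  (forall y, (norm1 (y - x) <= k)%N -> f y = g y) ->
  iter k (@laplacian R d) f x = iter k (@laplacian R d) g x.
Proof.
elim: k f g => [|k IH] f g fg.
  by apply: fg; rewrite subrr /norm1 big1// => i _; rewrite mxE.
rewrite !iterSr; apply: IH => y yk; rewrite /laplacian; congr (_ * _).
apply: eq_bigr => s _; rewrite !fg//; first exact: leqW.
by rewrite addrAC (leq_trans (norm1D _ _))// norm1_unit_step addn1.
Qed.

(** Average v^2 - u^2 = (v - u)^2 + 2 u (v - u) over the neighbouring values v; harmonicity kills
    the last term. *)
Lemma laplacian_sqr u x : laplacian u x = 0 ->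
  laplacian (fun y => u y ^+ 2) x =
  (2 * d%:R)^-1 * \sum_(s : 'I_d * bool) (u (x + unit_step s) - u x) ^+ 2.
Proof.
move=> ux; transitivity ((2 * d%:R)^-1 *
    (\sum_(s : 'I_d * bool) (u (x + unit_step s) - u x) ^+ 2) +
  2 * u x * laplacian u x); last by rewrite ux mulr0 addr0.
rewrite /laplacian [X in _ + X]mulrCA -mulrDr; congr (_ * _).
by rewrite mulr_sumr -big_split /=; apply: eq_bigr => s _; ring.
Qed.

Lemma iter_laplacian_sqr_ge0 k u x :
  (forall y, (norm1 (y - x) < k)%N -> laplacian u y = 0) ->
  0 <= iter k (@laplacian R d) (fun y => u y ^+ 2) x.
Proof.
elim: k u => [|k IH] u hu; first by rewrite /= sqr_ge0.
rewrite iterSr (@iter_laplacian_local _ _ (fun y => (2 * d%:R)^-1 *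
   \sum_(s : 'I_d * bool) (u (y + unit_step s) - u y) ^+ 2)); last first.
  by move=> y yk; rewrite laplacian_sqr// hu.
rewrite iter_laplacianZ_sum mulr_ge0 ?(ltW step_weight_gt0)//.
apply: sumr_ge0 => s _; apply: IH => y yk.
(* The difference u(. + s) - u is harmonic at y, since y and y + s both lie within distance k of x,
   where [hu] applies. *)
have shift : laplacian (fun z => u (z + unit_step s)) y = laplacian u (y + unit_step s).
  rewrite /laplacian; congr (_ * _); apply: eq_bigr => t _.
  by rewrite addrAC.
have -> : laplacian (fun z => u (z + unit_step s) - u z) y =
   laplacian (fun z => u (z + unit_step s)) y - laplacian u y.
  rewrite -mulN1r -laplacianZ -laplacianD; congr laplacian.
  by apply/funext => z; rewrite mulN1r.
rewrite shift !hu ?subr0//; first by rewrite ltnS ltnW.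
by rewrite addrAC (leq_ltn_trans (norm1D _ _))// norm1_unit_step addn1 ltnS.
Qed.

Lemma harmonic_on_ball_laplacian M u x :
  harmonic_on_ball M u -> (norm1 x < M)%N -> laplacian u x = 0.
Proof.
move=> hu xM; apply: hu => s; rewrite /l1ball /=.
by rewrite (leq_trans (norm1D _ _))// norm1_unit_step addn1.
Qed.

End lattice_operators.

(** * The law of the walk *)

Local Open Scope classical_set_scope.
Local Open Scope ring_scope.

Lemma unit_step_inj d : injective (@unit_step d).
Proof.
move=> [i a] [j b] E.
have := congr1 (fun x : lattice d => x 0 i) E.
rewrite /unit_step /=.
have [->|ij] := eqVneq i j.
  by case: a b {E} => [] []; rewrite !mxE ?eqxx.
by case: a b {E} => [] []; rewrite !mxE ?eqxx ?(negbTE ij).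
Qed.

(** The events cover the space only up to a null set, as the increments of the walk are unit steps
    only almost surely. *)
Lemma ge0_integral_ae_partition (R : realType) (dsp : measure_display)
    (T : measurableType dsp) (Pr : probability T R) (I : finType)
    (F : I -> set T) (D : set T) (f : T -> \bar R) :
  (forall i, measurable (F i)) -> trivIset setT F ->
  (\sum_i Pr (F i) = 1)%E -> measurable D ->
  measurable_fun setT f -> (forall x, 0 <= f x)%E ->
  (\int[Pr]_(x in D) f x = \sum_i \int[Pr]_(x in D `&` F i) f x)%E.
Proof.
move=> mF tF F1 mD mf f0.
pose U := \big[setU/set0]_(i <- index_enum I) F i.
have mU : measurable U by exact: bigsetU_measurable.
have PU : Pr U = 1%E.
  rewrite -F1 /U -bigcup_seq measure_fin_bigcup//.
    by rewrite -fsbig_seq ?index_enum_uniq.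
  by apply: sub_trivIset tF.
rewrite (@ge0_negligible_integral _ _ _ Pr D (~` U))//.
- have -> : D `\` ~` U = \big[setU/set0]_(i <- index_enum I) (D `&` F i).
    by rewrite setDE setCK -big_distrr.
  rewrite ge0_integral_bigsetU ?index_enum_uniq//.
  + by move=> i; exact: measurableI.
  + by move=> i j _ _ [x [[_ Fi] [_ Fj]]]; apply: tF => //; exists x.
  + exact: measurable_funTS.
- exact: measurableC.
- exact: measurable_funTS.
- by have := probability_setC Pr mU; rewrite PU subee.
Qed.

Section random_walk.
Context (R : realType) (d : nat) (d0 : (0 < d)%N).
Context (dsp : measure_display) (T : measurableType dsp) (Pr : probability T R).
Context (X : nat -> T -> lattice d).
Hypothesis srw : simple_random_walk Pr X.

Let xi n w := X n.+1 w - X n w.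

(** Measurability is given for single positions only; a union over the countably many values of
    [X n] transfers it to increments. *)
Lemma measurable_increment n x : measurable (xi n @^-1` [set x]).
Proof.
have [_ mX _ _] := srw.
have -> : xi n @^-1` [set x] =
    \bigcup_(y : lattice d) (X n @^-1` [set y] `&` X n.+1 @^-1` [set y + x]).
  apply/seteqP; split=> w /=.
    by move=> <-; exists (X n w) => //; split => //=; rewrite /xi addrC subrK.
  by move=> [y _ [/= <- E]]; rewrite /xi E addrAC subrr add0r.
apply: countable_bigcupT_measurable; first exact: countableP.
by move=> y; apply: measurableI.
Qed.

Lemma measurable_function_of_walk n (g : lattice d -> R) :
  measurable_fun setT (fun w => (g (X n w))%:E).
Proof.
have [_ mX _ _] := srw.
apply/measurable_EFinP => _ B mB; rewrite setTI.
exact: (mX n (g @^-1` B)).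
Qed.

(** Cylinder event, as an intersection over a list to fit [mutually_independent]; only the first [n]
    letters of [z] matter. *)
Definition word_event n (z : nat -> 'I_d * bool) : set T :=
  \bigcap_(j in [set` iota 0 n]) xi j @^-1` [set unit_step (z j)].

Lemma word_eventP n z w :
  word_event n z w <-> forall j, (j < n)%N -> xi j w = unit_step (z j).
Proof.
by split=> W j => [jn|]; first apply: W; rewrite /mkset mem_iota// => /W.
Qed.

Lemma measurable_word_event n z : measurable (word_event n z).
Proof.
by apply: fin_bigcap_measurable => // j _; exact: measurable_increment.
Qed.

Lemma probability_word_event n z :
  Pr (word_event n z) = ((2 * d%:R)^-1 ^+ n)%:E.
Proof.
have [_ _ Pxi ind] := srw.
rewrite /word_event (ind _ (fun j => [set unit_step (z j)])) ?iota_uniq//.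
under eq_bigr do rewrite Pxi.
by rewrite prodEFin -{1}(subn0 n) -/(index_iota 0 n) prodr_const_nat subn0.
Qed.

Lemma word_event_rcons n z s :
  word_event n z `&` xi n @^-1` [set unit_step s] =
  word_event n.+1 (fun j => if j == n then s else z j).
Proof.
apply/seteqP; split=> w; rewrite /setI /mkset !word_eventP.
  move=> [Wz xn] j; rewrite ltnS leq_eqVlt; case: eqP => [->//|_ /=].
  exact: Wz.
move=> W; split; last by have := W n (ltnSn n); rewrite eqxx.
by move=> j jn; have := W j (ltnW jn); rewrite ltn_eqF.
Qed.

Lemma walk_on_word_event n z w : word_event n z w ->
  X n w = \sum_(0 <= j < n) unit_step (z j).
Proof.
have [X0 _ _ _] := srw.
move/word_eventP => W.
have := telescope_sumr (fun j => X j w) (leq0n n); rewrite X0 subr0 => <-.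
rewrite !big_nat; apply: eq_bigr => j /andP[_ jn].
exact: W.
Qed.

(** The Markov property in integrated form. Splitting by the next increment trades one unit of [k]
    for one more letter; each of the 2d extensions has relative weight 1/(2d), as in [step_mean]. *)
Lemma integral_word_event k n z (g : lattice d -> R) : (forall x, 0 <= g x) ->
  (\int[Pr]_(w in word_event n z) (g (X (n + k) w))%:E =
   ((2 * d%:R)^-1 ^+ n *
    iter k (@step_mean R d) g (\sum_(0 <= j < n) unit_step (z j)))%:E)%E.
Proof.
move=> g0; elim: k n z => [|k IH] n z.
  rewrite addn0 (eq_integral (cst (g (\sum_(0 <= j < n) unit_step (z j)))%:E)).
    rewrite integral_cst; last exact: measurable_word_event.
    by rewrite [X in (_ * X)%E](probability_word_event n z) -EFinM mulrC.
  by move=> w; rewrite inE => /walk_on_word_event ->.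
have [_ _ Pxi _] := srw.
rewrite (@ge0_integral_ae_partition _ _ _ _ ('I_d * bool)%type
  (fun s => xi n @^-1` [set unit_step s])).
- under eq_bigr do rewrite word_event_rcons addnS -addSn IH.
  rewrite sumEFin -mulr_sumr exprSr -mulrA /=; congr (_ * _)%:E.
  rewrite {2}/step_mean; congr (_ * _); apply: eq_bigr => s _.
  rewrite big_nat_recr//= eqxx; congr (iter k _ g (_ + _)).
  by rewrite !big_nat; apply: eq_bigr => j /andP[_ jn]; rewrite ltn_eqF.
- by move=> s; exact: measurable_increment.
- by move=> s t _ _ [w [/= -> /unit_step_inj]].
- under eq_bigr do rewrite Pxi.
  rewrite sumEFin sumr_const card_unit_steps -[_ *+ (2 * d)%N]mulr_natl natrM divff//.
  by rewrite mulf_neq0// pnatr_eq0 -lt0n.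
- exact: measurable_word_event.
- exact: measurable_function_of_walk.
- by move=> w; rewrite lee_fin.
Qed.

Lemma Q_step_mean u n :
  Q Pr X u n = iter n (@step_mean R d) (fun x => u x ^+ 2) 0.
Proof.
(* The empty word gives the whole space; its letter is an arbitrary filler. *)
have := @integral_word_event n 0 (fun=> (Ordinal d0, true)) (fun x => u x ^+ 2).
have -> : word_event 0 (fun=> (Ordinal d0, true)) = setT.
  by apply/seteqP; split=> // w _; apply/word_eventP.
rewrite big_geq// expr0 mul1r add0n.
rewrite /Q unlock => ->//= x; exact: sqr_ge0.
Qed.
End random_walk.

Local Close Scope classical_set_scope.

Theorem theorem1p17 (R : realType) (P p : R) (hP : 1 < P) (hPp : P < p * P)
    (alpha : R) (halpha : P `^ alpha = p `^ (1 - alpha))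
    (c : R) (hc : c = 2 * (alpha * P + (1 - alpha) * (1 / p) - 1)) :
  exists n0 : nat,
    forall (d : nat), (0 < d)%N ->
    forall (dsp : measure_display) (Omega : measurableType dsp)
      (Pr : probability Omega R) (X : nat -> Omega -> lattice d),
    simple_random_walk Pr X ->
    forall (rad : nat) (u : lattice d -> R),
    harmonic_on_ball `|Num.ceil (p * P * rad%:R)|%N u ->
    forall epsilon : R, 0 <= epsilon <= 1 / 2 ->
    forall n : nat, (n0 <= n <= rad)%N ->
      Q Pr X u `|Num.floor (P * n%:R)|%N <=
        expR (c * n%:R `^ (- (2 * epsilon))) *
          Q Pr X u n `^ alpha *
          Q Pr X u `|Num.ceil (p * P * n%:R)|%N `^ (1 - alpha) +
        p `^ (- n%:R `^ (1 / 2 - epsilon)) *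
          Q Pr X u `|Num.ceil (p * P * n%:R)|%N.
Proof.
have P0 : 0 < P by rewrite (lt_trans _ hP).
have p1 : 1 < p by rewrite -(ltr_pM2r P0) mul1r.
have pP0 : 0 < p * P by rewrite mulr_gt0// (lt_trans _ p1).
have [n0 Hn0] := absolutely_monotone_three_points hP p1 halpha hc.
exists n0 => d d0 dsp Omega Pr X srw rad u harm e he n /andP[n0n nrad].
have ceilE (j : nat) :
    `|Num.ceil (p * P * j%:R)|%N%:R = (Num.ceil (p * P * j%:R))%:~R :> R.
  have x0 : 0 <= p * P * j%:R by rewrite mulr_ge0// ltW.
  by rewrite pmulrn gez0_abs// ceil_ge0// (lt_le_trans _ x0)// ltrN10.
apply: (Hn0 _ _ _ n0n _ _ (fun k : 'I_ _.+1 =>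
    iter k (@laplacian R d) (fun x => u x ^+ 2) 0)) => //.
- have Pn0 : 0 <= P * n%:R by rewrite mulr_ge0// ltW.
  by rewrite pmulrn gez0_abs ?floor_ge0// floor_le.
- by rewrite ceilE ceil_ge.
(* Harmonicity is needed where |y| < k <= ceil(p P n), and n <= rad keeps this inside the given
   ball. *)
- move=> k; apply: iter_laplacian_sqr_ge0 => // y; rewrite subr0 => yk.
  apply: (harmonic_on_ball_laplacian harm).
  apply: leq_trans yk _; apply: (leq_trans (leq_ord k)).
  rewrite -(ler_nat R) !ceilE ler_int le_ceil//.
  by rewrite ler_pM2l// ler_nat.
- by move=> j jN; rewrite (Q_step_mean d0 srw) (iter_step_mean_newton d0 _ _ jN).
Qed.
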